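(* If $G$ and $H$ are connected graphs and $G\,\square\,H$ denotes their Cartesian product, then \[ \mathrm{gp}(G\,\square\,H)\ge \mathrm{gp}(G)+\mathrm{gp}(H)-2 . \]
   Context: Graphs are finite, undirected and simple. The Cartesian product $G\,\square\,H$ has vertex set $V(G)\times V(H)$, and $(g,h)$, $(g',h')$ are adjacent if either $gg'\in E(G)$ and $h=h'$, or $g=g'$ and $hh'\in E(H)$. For a graph $G$, $d_G$ is the shortest-path distance; a $u,v$-geodesic is a $u,v$-path of length $d_G(u,v)$. A set $S\subseteq V(G)$ is a general position set of $G$ if no vertex of $S$ lies on a geodesic between two other vertices of $S$. The general position number $\mathrm{gp}(G)$ is the maximum cardinality of a general position set of $G$. *)

(* Defs.v *)
From mathcomp Require Import all_boot.

Set Implicit Arguments.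
Unset Strict Implicit.
Unset Printing Implicit Defensive.

Record sgraph := SGraph {
  vertex :> finType;
  adj : rel vertex;
  adj_sym : symmetric adj;
  adj_irr : irreflexive adj }.

(* The null graph is not regarded as connected. *)
Definition connected (G : sgraph) : Prop :=
  0 < #|G| /\ forall x y : G, connect (@adj G) x y.

Definition cart_adj (G H : sgraph) : rel (G * H) :=
  fun x y => (adj x.1 y.1 && (x.2 == y.2)) || ((x.1 == y.1) && adj x.2 y.2).

Lemma cart_adj_sym (G H : sgraph) : symmetric (@cart_adj G H).
Proof.
move=> x y; rewrite /cart_adj (adj_sym x.1) (adj_sym x.2).
by rewrite (eq_sym x.1) (eq_sym x.2).
Qed.

Lemma cart_adj_irr (G H : sgraph) : irreflexive (@cart_adj G H).
Proof. by move=> x; rewrite /cart_adj !adj_irr andbF. Qed.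

Definition cart_prod (G H : sgraph) : sgraph :=
  SGraph (@cart_adj_sym G H) (@cart_adj_irr G H).

Section GeneralPosition.
Variable G : sgraph.
Implicit Types (u v w : G) (p : seq G) (S : {set G}).

(* The path with vertex sequence u :: p, whose length is size p. *)
Definition uvpath u v p : bool :=
  [&& path (@adj G) u p, last u p == v & uniq (u :: p)].

(* Paths do not repeat vertices, so their lengths are below #|G|; the value
   is #|G| when u and v lie in different components. *)
Definition dist u v : nat :=
  \big[minn/#|G|]_(n < #|G| | [exists p : n.-tuple G, uvpath u v p]) n.

Definition geodesic u v p : bool := uvpath u v p && (size p == dist u v).

Definition on_geodesic u v w : bool :=
  [exists p : (dist u v).-tuple G, geodesic u v p && (w \in u :: p)].

Definition general_position S : bool :=
  [forall u in S, forall v in S, forall w in S,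
     [&& u != v, w != u & w != v] ==> ~~ on_geodesic u v w].

Definition gp : nat := \max_(S : {set G} | general_position S) #|S|.

End GeneralPosition.

(* Main.v *)
(** Fix maximum general position sets [S] of [G] and [T] of [H], and points
    [g] in [S] and [h] in [T].  The cross formed by [S :\ g] in the layer of
    [h] and by [T :\ h] in the layer of [g] is in general position.  Indeed
    distances in the product are sums of distances in the factors, so if [w]
    lies between [u] and [v] in the cross, then each coordinate of [w] lies
    between those of [u] and [v]; as all these coordinates are in [S] or in [T],
    each coordinate of [w] is that of [u] or that of [v].  Exactly one of the
    equations [x.1 = g] and [x.2 = h] holds at a point [x] of the cross, which
    forces [w] to be [u] or [v]. *)

Require Import Defs.
From mathcomp Require Import all_boot all_order zify.
Import Order.TTheory.

Set Implicit Arguments.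
Unset Strict Implicit.
Unset Printing Implicit Defensive.

(** * Distances and betweenness in one graph *)

Section Distance.
Variable G : sgraph.
Implicit Types (u v w : G) (p : seq G) (S : {set G}).

Definition between u w v : bool := dist u w + dist w v == dist u v.

Lemma uvpath_size u v p : uvpath u v p -> size p < #|G|.
Proof. by case/and3P=> _ _ /card_uniqP Up; rewrite -[_.+1]Up max_card. Qed.

Lemma dist_le_uvpath u v p : uvpath u v p -> dist u v <= size p.
Proof.
move=> uvp; rewrite /dist -minEnat -leEnat.
apply: (bigmin_inf (Ordinal (uvpath_size uvp))) => //=.
by apply/existsP; exists (in_tuple p).
Qed.

Lemma dist_le_path u v p :
  path (@adj G) u p -> last u p = v -> dist u v <= size p.
Proof.
move=> up <-; case: (shortenP up) => q uq Uq sqp.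
apply: (@leq_trans (size q)).
  by apply: dist_le_uvpath; rewrite /uvpath uq eqxx.
by apply: uniq_leq_size sqp; case/andP: Uq.
Qed.

(** Shortening the walk to a path keeps only vertices of [p] and cannot go below the distance, so
    nothing was removed and [p] repeats no vertex. *)
Lemma path_geodesic u v p :
  path (@adj G) u p -> last u p = v -> size p <= dist u v -> geodesic u v p.
Proof.
move=> up lp sp; rewrite /geodesic /uvpath up lp eqxx eqn_leq sp dist_le_path //.
rewrite /= andbT -[_ && _]/(uniq (u :: p)).
move: lp; case: (shortenP up) => r ur Ur srp lr.
apply: leq_size_uniq Ur _ _; last exact: leq_trans sp (dist_le_path ur lr).
by move=> x; rewrite !inE => /orP[->|/srp->]; rewrite ?orbT.
Qed.

Lemma distxx u : dist u u = 0.
Proof. by apply/eqP; rewrite -leqn0; apply: (@dist_le_path _ _ [::]). Qed.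

Lemma dist_adj u v : adj u v -> dist u v <= 1.
Proof. by move=> uv; apply: (@dist_le_path _ _ [:: v]); rewrite //= uv. Qed.

Lemma dist_geodesic u v : connect (@adj G) u v -> exists p, geodesic u v p.
Proof.
case/connectP=> p0 /shortenP[p up Up _] ->.
have uvp : uvpath u (last u p) p by rewrite /uvpath up eqxx.
have [|n _|n /existsP[q uvq]] := @eq_bigmin _ _ _ #|G|
    (Ordinal (uvpath_size uvp))
    [pred n : 'I_#|G| | [exists q : n.-tuple G, uvpath u (last u p) q]]
    (@nat_of_ord _).
- by apply/existsP; exists (in_tuple p).
(* The default [#|G|] exceeds every index, so the minimum is attained at a path length. *)
- by rewrite leEnat ltnW.
rewrite minEnat -/(dist _ _) => dE.
by exists q; rewrite /geodesic uvq size_tuple dE eqxx.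
Qed.

Hypothesis connG : connected G.

Lemma geodesic_ex u v : exists p, geodesic u v p.
Proof. exact/dist_geodesic/connG.2. Qed.

Lemma dist_eq0 u v : (dist u v == 0) = (u == v).
Proof.
apply/idP/eqP=> [/eqP d0|->]; last by rewrite distxx.
have [[|x p] /andP[/and3P[_ /eqP]]] := geodesic_ex u v => //.
by rewrite d0.
Qed.

Lemma dist_triangle u w v : dist u v <= dist u w + dist w v.
Proof.
have [p /andP[/and3P[up /eqP lp _] /eqP<-]] := geodesic_ex u w.
have [q /andP[/and3P[wq /eqP lq _] /eqP<-]] := geodesic_ex w v.
by rewrite -size_cat dist_le_path ?cat_path ?last_cat ?lp ?up.
Qed.

(** Cutting a geodesic at [w] bounds both distances; conversely, geodesics through [w] concatenate
    to a walk of length [dist u v]. *)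
Lemma on_geodesicE u v w : on_geodesic u v w = between u w v.
Proof.
apply/existsP/eqP=> [[p /andP[/andP[/and3P[up /eqP lp _] /eqP sp] wp]]|duwv].
  apply/eqP; rewrite eqn_leq dist_triangle -sp andbT.
  case/splitPl: wp up lp => p1 p2 lp1; rewrite cat_path last_cat lp1 size_cat.
  by case/andP=> up1 wp2 lp2; rewrite leq_add ?dist_le_path.
have [p /andP[/and3P[up /eqP lp _] /eqP sp]] := geodesic_ex u w.
have [q /andP[/and3P[wq /eqP lq _] /eqP sq]] := geodesic_ex w v.
have spq : size (p ++ q) == dist u v by rewrite size_cat sp sq duwv.
exists (Tuple spq); rewrite path_geodesic ?(eqP spq) //=.
- by rewrite -cat_cons mem_cat -[in w \in _]lp mem_last.
- by rewrite cat_path up lp.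
by rewrite last_cat lp.
Qed.

Lemma general_positionP S :
  reflect {in S & &, forall u w v, between u w v -> w = u \/ w = v}
          (general_position S).
Proof.
apply: (iffP idP) => [gpS u w v uS wS vS uwv | gpS].
  have [->|wu] := eqVneq w u; first by left.
  have [->|wv] := eqVneq w v; first by right.
  (* If [u = v], betweenness forces [dist u w = 0], hence [w = u]. *)
  have uv : u != v.
    apply: contraNneq wu => uv; move: uwv.
    by rewrite /between -uv distxx addn_eq0 dist_eq0 eq_sym => /andP[].
  have /implyP := forall_inP (forall_inP (forall_inP gpS u uS) v vS) w wS.
  by rewrite uv wu wv on_geodesicE uwv => /(_ isT).
apply/forall_inP=> u uS; apply/forall_inP=> v vS; apply/forall_inP=> w wS.
apply/implyP=> /and3P[_ wu wv]; rewrite on_geodesicE.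
by apply/negP=> /gpS[]// /eqP; apply/negP.
Qed.

(** Singletons are in general position, so a maximum set is nonempty and supplies a centre for the
    cross. *)
Lemma gp_attained :
  exists S g, [/\ general_position S, g \in S & #|S| = gp G].
Proof.
have [g _] := card_gt0P connG.1.
have gp1 : general_position [set g].
  by apply/general_positionP => u w v /set1P-> /set1P->; left.
have [|S gpS gpE] := @eq_bigmax_cond _ [pred S : {set G} | general_position S]
   (fun S : {set G} => #|S|); first by apply/card_gt0P; exists [set g].
have /card_gt0P[z zS] : 0 < #|S|.
  by rewrite -gpE -(cards1 g); apply: leq_bigmax_cond.
by exists S, z.
Qed.

End Distance.

(** * Distances in the product and the cross *)

Section CartesianProduct.
Variables G H : sgraph.
Implicit Types (g : G) (h : H) (x y : cart_prod G H).

Lemma cart_path_fst h g p : path (@adj G) g p ->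
  path (@adj (cart_prod G H)) (g, h) [seq (z, h) | z <- p].
Proof.
rewrite path_map; apply: sub_path => a b ab.
by rewrite /= /cart_adj ab eqxx.
Qed.

Lemma cart_path_snd g h p : path (@adj H) h p ->
  path (@adj (cart_prod G H)) (g, h) [seq (g, z) | z <- p].
Proof.
rewrite path_map; apply: sub_path => a b ab.
by rewrite /= /cart_adj ab eqxx orbT.
Qed.

Hypotheses (connG : connected G) (connH : connected H).

Lemma cart_path_ex x y : exists p,
  [/\ path (@adj (cart_prod G H)) x p, last x p = y
    & size p = dist x.1 y.1 + dist x.2 y.2].
Proof.
case: x y => [g h] [g' h'] /=.
have [p /andP[/and3P[gp /eqP lp _] /eqP<-]] := geodesic_ex connG g g'.
have [q /andP[/and3P[hq /eqP lq _] /eqP<-]] := geodesic_ex connH h h'.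
exists ([seq (z, h) | z <- p] ++ [seq (g', z) | z <- q]); split.
- by rewrite cat_path cart_path_fst // last_map lp cart_path_snd.
- by rewrite last_cat last_map lp last_map lq.
by rewrite size_cat !size_map.
Qed.

Lemma cart_connected : connected (cart_prod G H).
Proof.
split=> [|x y]; first by rewrite card_prod muln_gt0 connG.1 connH.1.
by have [p [xp lp _]] := cart_path_ex x y; apply/connectP; exists p.
Qed.

(** Each edge moves one coordinate by distance at most 1 and fixes the other. *)
Lemma cart_path_size x p : path (@adj (cart_prod G H)) x p ->
  dist x.1 (last x p).1 + dist x.2 (last x p).2 <= size p.
Proof.
elim: p x => [|y p IHp] x /=; first by rewrite !distxx.
case/andP=> xy /IHp /=; set z := last y p => le_p.
have := dist_triangle connG x.1 y.1 z.1.
have := dist_triangle connH x.2 y.2 z.2.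
case/orP: xy => [/andP[/dist_adj le1 /eqP->]|/andP[/eqP-> /dist_adj le1]];
  rewrite distxx; lia.
Qed.

Lemma dist_cart x y : dist x y = dist x.1 y.1 + dist x.2 y.2.
Proof.
apply/eqP; rewrite eqn_leq; apply/andP; split.
  by have [p [xp lp <-]] := cart_path_ex x y; apply: dist_le_path.
have [p /andP[/and3P[xp /eqP lp _] /eqP<-]] := geodesic_ex cart_connected x y.
by rewrite -lp cart_path_size.
Qed.

(** The triangle inequalities of the factors add up to an equality only if both are equalities. *)
Lemma between_cart x z y :
  between x z y = between x.1 z.1 y.1 && between x.2 z.2 y.2.
Proof.
rewrite /between !dist_cart.
have := dist_triangle connG x.1 z.1 y.1.
have := dist_triangle connH x.2 z.2 y.2.
lia.
Qed.

(** The centre [(g, h)] is left out: it lies between any two points on different arms. *)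
Definition cross (S : {set G}) (T : {set H}) g h : {set cart_prod G H} :=
  setX (S :\ g) [set h] :|: setX [set g] (T :\ h).

Lemma card_cross (S : {set G}) (T : {set H}) g h :
  #|S| + #|T| - 2 <= #|cross S T g h|.
Proof.
have -> : #|cross S T g h| = #|S :\ g| + #|T :\ h|.
  rewrite cardsU !cardsX !cards1 muln1 mul1n.
  rewrite (_ : _ :&: _ = set0) ?cards0 ?subn0 //.
  (* The first coordinate is [g] on one arm only. *)
  by apply/setP=> -[a b]; rewrite !inE /=; case: (a == g); rewrite ?andbF.
by rewrite (cardsD1 g S) (cardsD1 h T); case: (g \in S); case: (h \in T); lia.
Qed.

Lemma cross_general_position (S : {set G}) (T : {set H}) g h :
    g \in S -> h \in T -> general_position S -> general_position T ->
  general_position (cross S T g h).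
Proof.
move=> gS hT /(general_positionP connG) gpS /(general_positionP connH) gpT.
have cross_arm x : x \in cross S T g h ->
    [/\ x.1 \in S, x.2 \in T & (x.1 == g) != (x.2 == h)].
  case: x => a b; rewrite !inE /=.
  by case/orP=> [/andP[/andP[/negPf-> ->] /eqP->]|/and3P[/eqP-> /negPf-> ->]];
     rewrite eqxx.
apply/(general_positionP cart_connected)=> -[u1 u2] [w1 w2] [v1 v2].
move=> /cross_arm[/= u1S u2T u_arm] /cross_arm[/= w1S w2T w_arm].
move=> /cross_arm[/= v1S v2T v_arm]; rewrite between_cart /=.
case/andP=> /gpS-/(_ u1S w1S v1S) w1E /gpT-/(_ u2T w2T v2T) w2E.
(* The mixed cases [(u1, v2)] and [(v1, u2)] remain. In the first, [u1 = g] gives [v2 != h], so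
   [v1 = g] and [w] is [v]; otherwise [v2 = h = u2] and [w] is [u]. The second is symmetric. *)
case: w1E w2E => [] w1E [] w2E; subst w1 w2; try by [left | right].
- move: w_arm u_arm v_arm; have [->|_] := eqVneq u1 g.
    by case: (eqVneq v2 h) => // _ _ _; case: (eqVneq v1 g) => // ->; right.
  by case: (eqVneq v2 h) => // -> _; case: (eqVneq u2 h) => // ->; left.
- move: w_arm v_arm u_arm; have [->|_] := eqVneq v1 g.
    by case: (eqVneq u2 h) => // _ _ _; case: (eqVneq u1 g) => // ->; left.
  by case: (eqVneq u2 h) => // -> _; case: (eqVneq v2 h) => // ->; right.
Qed.

End CartesianProduct.

Theorem theorem3p1 (G H : sgraph) (hG : connected G) (hH : connected H) :
  gp (cart_prod G H) >= gp G + gp H - 2.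
Proof.
have [S [g [gpS gS <-]]] := gp_attained hG.
have [T [h [gpT hT <-]]] := gp_attained hH.
apply: leq_trans (card_cross S T g h) _.
exact/leq_bigmax_cond/cross_general_position.
Qed.
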